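(* Let $T_d^2$ be the complete binary tree of depth $d$ and let $n=2^d-1$ be its number of vertices. Then $\mathrm{thinness}(T_d^2)=\Omega(\log n)$; that is, there exist constants $c>0$ and $d_0$ such that $\mathrm{thinness}(T_d^2)\ge c\log n$ for all $d\ge d_0$. In particular, there exist trees with arbitrarily large thinness.
   Context: The thinness of a finite simple undirected graph $G=(V,E)$ with $n=|V|$ is the minimum positive integer $k$ such that there exist an ordering $v_1,v_2,\dots,v_n$ of the vertices of $G$ and a partition $V_1,\dots,V_k$ of $V$ into $k$ disjoint sets satisfying: for any triple $(r,s,t)$ with $r<s<t$, if $v_r$ and $v_s$ belong to the same set $V_i$ and $v_t$ is adjacent to $v_r$, then $v_t$ is adjacent to $v_s$. The depth of a rooted tree is the number of nodes on the longest path starting from the root and ending at a leaf. The complete binary tree $T_d^2$ of depth $d$ is the rooted tree in which every non-leaf node has exactly 2 children and every root-to-leaf path has exactly $d$ nodes. *)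

(* Defs.v *)
From mathcomp Require Import all_boot.

Set Implicit Arguments.
Unset Strict Implicit.
Unset Printing Implicit Defensive.

Record sgraph := SGraph {
  vertex :> finType;
  adj : rel vertex;
  adj_sym : symmetric adj;
  adj_irrefl : irreflexive adj
}.

Definition graph_connected (G : sgraph) : Prop :=
  forall x y : G, connect (@adj G) x y.

Definition graph_acyclic (G : sgraph) : Prop :=
  forall c : seq G, 2 < size c -> ~ ucycle (@adj G) c.

Definition is_tree (G : sgraph) : Prop :=
  [/\ 0 < #|G|, graph_connected G & graph_acyclic G].

(* The ordering is v 0, v 1, ..., indexed from 0; v is injective between sets
   of the same cardinality, hence bijective. *)
Definition ordering (G : sgraph) (v : {ffun 'I_#|G| -> G}) : bool :=
  injectiveb v.

(* Classes may be empty: this does not affect the least number of classes of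
   a graph with at least one vertex. *)
Definition vertex_partition (G : sgraph) (k : nat) (V : {ffun 'I_k -> {set G}}) : bool :=
  [forall i, forall j, (i != j) ==> [disjoint V i & V j]]
  && (\bigcup_i V i == [set: G]).

Definition consistent (G : sgraph) (k : nat)
    (v : {ffun 'I_#|G| -> G}) (V : {ffun 'I_k -> {set G}}) : bool :=
  [forall r : 'I_#|G|, forall s : 'I_#|G|, forall t : 'I_#|G|, forall i : 'I_k,
     [&& r < s, s < t, v r \in V i, v s \in V i & adj (v t) (v r)]
     ==> adj (v t) (v s)].

Definition thin (G : sgraph) (k : nat) : bool :=
  [exists v : {ffun 'I_#|G| -> G}, exists V : {ffun 'I_k -> {set G}},
     [&& ordering v, vertex_partition V & consistent v V]].

Lemma thin_exists (G : sgraph) : exists k, (0 < k) && thin G k.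
Proof.
exists #|G|.+1; rewrite /=; apply/existsP; exists [ffun i : 'I_#|G| => enum_val i].
apply/existsP; exists [ffun i : 'I_#|G|.+1 => [set x : G | enum_rank x == i :> nat]].
apply/and3P; split.
- by apply/injectiveP => i j; rewrite !ffunE; apply: enum_val_inj.
- apply/andP; split.
    apply/forallP => i; apply/forallP => j; apply/implyP => nij.
    rewrite -setI_eq0; apply/eqP/setP => x; rewrite !ffunE !inE.
    apply: contraNF nij => /andP[/eqP xi /eqP xj].
    by apply/eqP/val_inj; rewrite /= -xi -xj.
  apply/eqP/setP => x; rewrite inE; apply/bigcupP.
  exists (widen_ord (leqnSn _) (enum_rank x)) => //.
  by rewrite ffunE inE.
- apply/forallP => r; apply/forallP => s; apply/forallP => t.
  apply/forallP => i; apply/implyP; rewrite !ffunE !inE !enum_valK.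
  case/and5P => rs _ /eqP ri /eqP si _.
  by move: rs; rewrite ri si ltnn.
Qed.

Definition thinness (G : sgraph) : nat := ex_minn (thin_exists G).

(* A node is the word of left/right choices on the way up to the root; the
   words have length less than d, so that root-to-leaf paths have d nodes. *)
Definition cbnode (d : nat) : finType := {i : 'I_d & i.-tuple bool}.

Definition word d (u : cbnode d) : seq bool := tagged u.

Definition child d (u w : cbnode d) : bool :=
  [exists b : bool, word w == b :: word u].

Definition cbadj d (u w : cbnode d) : bool := child u w || child w u.

Lemma size_word d (u : cbnode d) : size (word u) = tag u.
Proof. by rewrite /word size_tuple. Qed.

Lemma word_inj d : injective (@word d).
Proof.
move=> u w uw; have tuw : tag u = tag w.
  by apply: val_inj; rewrite /= -!size_word uw.
case: u w uw tuw => i s [j t] /= uw eij; subst j.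
by congr existT; apply: val_inj.
Qed.

Lemma word_exists d (s : seq bool) : size s < d -> exists u : cbnode d, word u = s.
Proof.
by move=> sd; exists (existT _ (Ordinal sd) (in_tuple s) : cbnode d).
Qed.

Lemma childP d (u w : cbnode d) :
  reflect (exists b, word w = b :: word u) (child u w).
Proof. by apply: (iffP existsP) => -[b /eqP]; exists b => //; apply/eqP. Qed.

Lemma child_size d (u w : cbnode d) :
  child u w -> size (word w) = (size (word u)).+1.
Proof. by case/childP => b ->. Qed.

Lemma child_uniq d (u u' w : cbnode d) : child u w -> child u' w -> u = u'.
Proof.
by case/childP => b e /childP[b']; rewrite e => -[_ uu']; apply: word_inj.
Qed.

Lemma cbadj_sym d : symmetric (@cbadj d).
Proof. by move=> u w; rewrite /cbadj orbC. Qed.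

Lemma cbadj_irrefl d : irreflexive (@cbadj d).
Proof.
move=> u; rewrite /cbadj orbb; case uu: (child u u) => //.
by move/eqP: (child_size uu); rewrite eqn_leq ltnn andbF.
Qed.

Definition cbtree (d : nat) : sgraph :=
  SGraph (@cbadj_sym d) (@cbadj_irrefl d).

Lemma card_cbtree d : #|cbtree d| = 2 ^ d - 1.
Proof.
rewrite /= card_tagged sumnE big_map big_enum /=.
under eq_bigr do rewrite card_tuple card_bool.
elim: d => [|d IH]; first by rewrite big_ord0.
rewrite big_ord_recr /= IH expnS mul2n -addnn addnBAC ?expn_gt0 //.
Qed.

Lemma card_children d (u : cbtree d) :
  #|[set w | child u w]| = (if size (word u) == d.-1 then 0 else 2).
Proof.
have sd : size (word u) < d by rewrite size_word.
case: eqP => [e|/eqP ne].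
  apply/eqP; rewrite cards_eq0; apply/eqP/setP => w; rewrite !inE.
  case uw: (child u w) => //; move: (child_size uw).
  rewrite e size_word => f.
  by move: (ltn_ord (tag w)); rewrite f (ltn_predK sd) ltnn.
have sd' : (size (word u)).+1 < d.
  by rewrite ltn_neqAle sd andbT; apply: contra ne => /eqP e; rewrite -[X in X == _]/(size (word u)).+1.-1 e.
have [w0 e0] := @word_exists d (false :: word u) sd'.
have [w1 e1] := @word_exists d (true :: word u) sd'.
have -> : [set w | child u w] = [set w0; w1].
  apply/setP => w; rewrite !inE; apply/childP/orP => [[b e]|[]/eqP->].
  - case: b e => e; [right|left]; apply/eqP/word_inj; by rewrite e ?e0 ?e1.
  - by exists false.
  - by exists true.
by rewrite cards2; case: eqP => // e; move: e0; rewrite e e1.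
Qed.

Lemma cbroot_exists d : 0 < d -> exists r : cbtree d, word r = [::].
Proof. by move=> d0; apply: word_exists. Qed.

Lemma size_root_leaf_path d (r : cbtree d) (p : seq (cbtree d)) :
  word r = [::] -> path (@child d) r p ->
  [set w | child (last r p) w] = set0 -> size (r :: p) = d.
Proof.
move=> r0 pp /eqP; rewrite -cards_eq0 card_children.
case: ifP => // /eqP e _.
have : size (word (last r p)) = size (word r) + size p.
  elim: p r {r0 e} pp => [|x p IH] r /=; first by rewrite addn0.
  by case/andP => /child_size rx /IH ->; rewrite rx addnS.
have d0 : 0 < d by apply: leq_trans (ltn_ord (tag r)).
by rewrite e r0 /= add0n => <-; rewrite prednK.
Qed.

Lemma cbtree_is_tree d : 0 < d -> is_tree (cbtree d).
Proof.
move=> d0; have [r r0] := cbroot_exists d0; split.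
- by apply/card_gt0P; exists r.
- have cr : forall x : cbtree d, connect (@adj (cbtree d)) r x.
    move=> x; move: {2}(word x) (erefl (word x)) => s.
    elim: s x => [|b s IH] x xs.
      by rewrite (_ : x = r) //; apply: word_inj; rewrite xs r0.
    have [|y ys] := @word_exists d s.
      by rewrite ltnW //; have := ltn_ord (tag x); rewrite -size_word xs.
    apply: connect_trans (IH y ys) (connect1 _).
    by apply/orP; left; apply/childP; exists b; rewrite xs ys.
  move=> x y; apply: connect_trans (cr y).
  by rewrite (sym_connect_sym (@adj_sym _)).
- move=> c c3 /andP[cc uc].
  have [x0 x0c] : exists x, x \in c by case: c c3 {cc uc} => // a c; exists a; rewrite inE eqxx.
  have [x xc xmax] : exists2 x, x \in c &
      forall y : cbtree d, y \in c -> size (word y) <= size (word x).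
    have [x xc xm] := @arg_maxnP (cbtree d) x0 [in c] (fun x => size (word x)) x0c.
    by exists x.
  case: (rot_to xc) => i c' ec.
  have {}cc : cycle (@adj (cbtree d)) (x :: c') by rewrite -ec rot_cycle.
  have {}uc : uniq (x :: c') by rewrite -ec rot_uniq.
  have {}c3 : 2 < size (x :: c') by rewrite -ec size_rot.
  have par y : y \in x :: c' -> adj x y -> child y x.
    rewrite -ec mem_rot => /xmax ym /orP[/child_size e|//].
    by move: ym; rewrite /= e ltnn.
  case: c' {ec} cc uc c3 par => [//|y c']; case: (lastP c') => [//|{}c' z].
  rewrite /= rcons_path last_rcons => /and3P[xy _ zx] /and3P[_ yz _] _ par.
  have yx : child y x by apply: par => //; rewrite !inE eqxx orbT.
  have zx' : child z x.
    apply: par; first by rewrite !inE mem_rcons inE eqxx !orbT.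
    by rewrite /= cbadj_sym.
  by move: yz; rewrite (child_uniq yx zx') mem_rcons inE eqxx.
Qed.

(* Main.v *)
Require Import Defs.
From mathcomp Require Import all_boot all_order all_algebra.
From mathcomp Require Import all_classical all_reals all_analysis.
From mathcomp Require Import zify lra.

(** Thinness is bounded below by induced matchings across a cut of the vertex
    ordering. Cut the ordering after a position [p], and let [a_i b_i] be edges
    with [a_i] before the cut and [b_i] after it, such that [a_i] is not
    adjacent to [b_j] for [i <> j]. If [a_i] and [a_j] lie in one class, with
    [a_i] the earlier one, then [b_i] comes after both and is adjacent to [a_i],
    so consistency makes it adjacent to [a_j], which is excluded. Hence the
    [a_i] lie in distinct classes, and there are at least as many classes as
    edges (lemma [cut_matching_size]).

    It remains to show that every ordering of a complete binary tree has a cut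
    with an induced matching of size linear in the depth. Suppose that every
    ordering of a tree of depth [d] has such a matching of size [m > 0]. In a
    tree of depth [d + 3], consider three subtrees of depth [d] whose roots lie
    at level 3 and have distinct parents. The induced ordering on each of them
    has a cut with [m] edges. Use the cut [p] of the subtree B whose cut is the
    middle one. One of the other two subtrees, A, was cut earlier, hence has a
    vertex before [p]; the third, C, was cut later, hence has a vertex after
    [p]. On the walk between these two vertices through the root of the whole
    tree, some edge crosses [p]. As the parents are distinct, the walk avoids
    B and the parent of its root, so this edge joins the [m] edges of B to an
    induced matching of size [m + 1] (lemma [matching_at_middle]). Thus depth
    [3 k + 2] forces more than [k] classes, which is logarithmic in the number
    of vertices. *)

Set Implicit Arguments.
Unset Strict Implicit.
Unset Printing Implicit Defensive.

Import Order.TTheory GRing.Theory Num.Theory.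

(** * Matchings across a cut and thinness *)

(** The rank [rk] of each vertex stands for an ordering, cut after rank [p]. The
    matching is induced only in the bipartite graph of the edges that cross
    the cut: adjacencies between two left ends, or two right ends, do no harm to
    the counting of classes. *)
Definition cut_matching (T : Type) (e : rel T) (rk : T -> nat) (p : nat)
    (M : seq (T * T)) : bool :=
  all (fun f => [&& e f.1 f.2, rk f.1 <= p & p < rk f.2]) M
  && pairwise (fun f g => ~~ e f.1 g.2 && ~~ e g.1 f.2) M.

Lemma thin_rank (G : sgraph) (k : nat) : thin G k ->
  exists (rk : G -> nat) (col : G -> 'I_k), injective rk /\
    forall x y z, rk x < rk y -> rk y < rk z -> col x = col y ->
      adj z x -> adj z y.
Proof.
case/existsP => v /existsP[V /and3P[/injectiveP vinj /andP[_ /eqP VT] cons]].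
have [g gK vK] : bijective v by apply: inj_card_bij => //; rewrite card_ord.
have inV x : exists i, x \in V i.
  have : x \in \bigcup_i V i by rewrite VT inE.
  by case/bigcupP => i _; exists i.
exists (fun x => nat_of_ord (g x)), (fun x => xchoose (inV x)); split.
  by move=> x y /val_inj/(congr1 v); rewrite !vK.
move=> x y z xy yz cxy zx; move/forallP/(_ (g x)): cons.
move/forallP/(_ (g y))/forallP/(_ (g z))/forallP/(_ (xchoose (inV x)))/implyP.
rewrite !vK; apply; rewrite xy yz zx (xchooseP (inV x)) andbT /=.
by rewrite cxy (xchooseP (inV y)).
Qed.

(** Two left ends of one class would, by consistency, both be adjacent to the
    right end of the earlier one, so the classes of the left ends are
    distinct. *)
Lemma cut_matching_size (G : sgraph) (k : nat) (rk : G -> nat)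
    (col : G -> 'I_k) (p : nat) (M : seq (G * G)) :
  injective rk ->
  (forall x y z, rk x < rk y -> rk y < rk z -> col x = col y ->
     adj z x -> adj z y) ->
  cut_matching (@adj G) rk p M -> size M <= k.
Proof.
move=> rkI cons /andP[cutM indM].
suff uc : uniq [seq col f.1 | f <- M].
  by rewrite -(card_ord k) -(size_map (fun f => col f.1)) -(card_uniqP uc) max_card.
rewrite uniq_pairwise pairwise_map.
apply: (sub_in_pairwise _ cutM indM) => -[a b] [a' b'].
rewrite !unfold_in /= => /and3P[ab ap pb] /and3P[ab' ap' pb'] /andP[nab' na'b].
apply/eqP => caa'; case: (ltngtP (rk a) (rk a')) => [lt|lt|/rkI eq].
- move/negP: na'b; apply; rewrite adj_sym; apply: (cons a) => //.
    exact: leq_ltn_trans pb.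
  by rewrite adj_sym.
- move/negP: nab'; apply; rewrite adj_sym; apply: (cons a') => //.
    exact: leq_ltn_trans pb'.
  by rewrite adj_sym.
- by move: na'b; rewrite -eq ab.
Qed.

Lemma leq_thinness (G : sgraph) (m : nat) :
  (forall rk : G -> nat, injective rk ->
     exists p M, cut_matching (@adj G) rk p M /\ size M = m) ->
  m <= thinness G.
Proof.
move=> H; rewrite /thinness; case: ex_minnP => k /andP[_ /thin_rank] + _.
case=> rk [col [rkI cons]]; have [p [M [cM <-]]] := H rk rkI.
exact: (cut_matching_size rkI cons cM).
Qed.

(** * The infinite binary tree of words *)

(** Working with all words, under a bound on their length, makes the subtree
    below a word [w] the image of the whole tree by [s |-> s ++ w], with rank
    function [s |-> rk (s ++ w)]; the trees of different depths need no
    embeddings into each other. *)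

Definition wchild (s t : seq bool) : bool :=
  if t is _ :: t' then t' == s else false.

Definition wadj (s t : seq bool) : bool := wchild s t || wchild t s.

Lemma size_wchild s t : wchild s t -> size t = (size s).+1.
Proof. by case: t => //= b t /eqP->. Qed.

Lemma catl_inj (w : seq bool) : injective (cat^~ w).
Proof.
move=> s t /= st; apply/eqP; move/eqP: st.
have [szst|ne] := eqVneq (size s) (size t); first by rewrite eqseq_cat // eqxx andbT.
move/eqP/(congr1 size)/eqP; rewrite !size_cat eqn_add2r => e.
by rewrite e in ne.
Qed.

Lemma wchild_cat s t w : wchild (s ++ w) (t ++ w) = wchild s t.
Proof.
case: t => [|b t] /=; last by rewrite (inj_eq (@catl_inj w)).
by apply/negP => /size_wchild; rewrite size_cat; lia.
Qed.

Lemma wadjC s t : wadj s t = wadj t s.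
Proof. exact: orbC. Qed.

Lemma wadj_cat s t w : wadj (s ++ w) (t ++ w) = wadj s t.
Proof. by rewrite /wadj !wchild_cat. Qed.

Lemma cbadjE d (u w : cbnode d) : cbadj u w = wadj (word u) (word w).
Proof.
have childE x y : child x y = @wchild (word x) (@word d y).
  apply/childP/idP => [[b ->]|]; first exact: eqxx.
  by case: (word y) => //= b t /eqP->; exists b.
by rewrite /cbadj !childE.
Qed.

(** The suffixes of [s] are its ancestors, so some edge on the path from [s] to
    the root crosses any cut that separates the two. *)
Lemma crossing_edge_above (rk : seq bool -> nat) p s :
  (rk s <= p) != (rk [::] <= p) ->
  exists a b, [/\ suffix a s, suffix b s, wadj a b, rk a <= p & p < rk b].
Proof.
elim: s => [|x s IH]; first by rewrite eqxx.
have [->|ne _] := eqVneq (rk (x :: s) <= p) (rk s <= p).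
  case/IH => a [b [sa sb ab ap bp]]; exists a, b.
  by split=> //; apply: suffix_trans (suffix_suffix [:: x] s).
have ss : suffix s (x :: s) := suffix_suffix [:: x] s.
have adj1 : wadj s (x :: s) by rewrite /wadj /wchild eqxx.
have adj2 : wadj (x :: s) s by rewrite wadjC.
move: ne; case: (leqP (rk (x :: s)) p); case: (leqP (rk s) p) => // sp xp _.
  by exists (x :: s), s; split=> //; exact: suffix_refl.
by exists s, (x :: s); split=> //; exact: suffix_refl.
Qed.

(** A word adjacent to the subtree below [wB] lies in it or is the parent of
    [wB], so in both cases it has [behead wB] as a suffix. An ancestor of a word
    below [wA] with this property would give that word two different suffixes
    of the same length, [behead wA] and [behead wB]. *)
Lemma nadj_subtree (wA wB s t a : seq bool) :
  size wA = size wB -> behead wA != behead wB -> suffix a (s ++ wA) ->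
  ~~ wadj a (t ++ wB).
Proof.
move=> szAB neAB sa; apply/negP => adj_at; move/eqP: neAB; apply.
have behead_suffix w : suffix (behead w) w by rewrite -drop1 suffix_drop.
have : suffix (behead wB) a.
  case/orP: adj_at; last first.
    case: a {sa} => //= x a /eqP ->; apply: suffix_trans (suffix_cons _ _).
    exact: suffix_trans (suffix_suffix _ _).
  case: t => [|x t] /=; first by case: wB {szAB} => //= x wB /eqP->; exact: suffix_refl.
  by move/eqP <-; exact: suffix_trans (suffix_suffix _ _).
move=> /suffix_trans /(_ sa); rewrite suffixE => /eqP <-.
have : suffix (behead wA) (s ++ wA) by apply: suffix_trans (suffix_suffix _ _).
by rewrite suffixE => /eqP <-; rewrite !size_behead szAB.
Qed.

(** * Growth of the matching with the depth *)

Definition shift (w : seq bool) (f : seq bool * seq bool) := (f.1 ++ w, f.2 ++ w).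

Lemma cut_matching_shift (rk : seq bool -> nat) p w M :
  cut_matching wadj (fun s => rk (s ++ w)) p M ->
  cut_matching wadj rk p (map (shift w) M).
Proof.
case/andP => cutM indM; apply/andP; split.
  rewrite all_map; apply: sub_all cutM => f /=.
  by rewrite wadj_cat.
rewrite pairwise_map; apply: sub_pairwise indM => f g /=.
by rewrite !wadj_cat.
Qed.

Definition matching_at (rk : seq bool -> nat) (d m p : nat) : Prop :=
  exists M, [/\ cut_matching wadj rk p M, size M = m &
    all (fun f => (size f.1 < d) && (size f.2 < d)) M].

(** This is what a subtree contributes when its own cut is not the one in use:
    one vertex on each side of its cut. *)
Lemma matching_at_ends rk d m p w n : size w = n -> 0 < m ->
  matching_at (fun s => rk (s ++ w)) d m p ->
  exists a b, [/\ size (a ++ w) < d + n, size (b ++ w) < d + n,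
    rk (a ++ w) <= p & p < rk (b ++ w)].
Proof.
move=> wn m0 [M [/andP[cutM _] Mm dM]]; case: M => [|[a b] M] in cutM Mm dM.
  by rewrite -Mm in m0.
exists a, b; move: cutM dM => /= /andP[/and3P[_ ap pb] _] /andP[/andP[ad bd] _].
by rewrite !size_cat wn !ltn_add2r.
Qed.

(** Subtree A has a vertex before [pB] and subtree C one after [pB]. One of the
    two is on the other side of the cut than the root, so an edge crosses on
    its path to the root, and this path keeps away from subtree B. *)
Lemma matching_at_middle (rk : seq bool -> nat) d m n wA wB wC pA pB pC :
  size wA = n -> size wB = n -> size wC = n ->
  behead wA != behead wB -> behead wC != behead wB -> 0 < m ->
  matching_at (fun s => rk (s ++ wA)) d m pA ->
  matching_at (fun s => rk (s ++ wB)) d m pB ->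
  matching_at (fun s => rk (s ++ wC)) d m pC ->
  pA <= pB -> pB <= pC ->
  matching_at rk (d + n) m.+1 pB.
Proof.
move=> wAn wBn wCn nA nC m0 + + + pAB pBC.
case/(matching_at_ends wAn m0) => a [_ [ad _ ap _]].
case=> M [/cut_matching_shift/andP[cutM indM] Mm dM].
case/(matching_at_ends wCn m0) => _ [c [_ cd _ pc]].
have {}ap : rk (a ++ wA) <= pB := leq_trans ap pAB.
have {}pc : pB < rk (c ++ wC) := leq_ltn_trans pBC pc.
have [w [s [wn nw sd cross]]] : exists w s, [/\ size w = n, behead w != behead wB,
    size (s ++ w) < d + n & (rk (s ++ w) <= pB) != (rk [::] <= pB)].
  have [rp|pr] := leqP (rk [::]) pB.
    by exists wC, c; rewrite (leqNgt (rk (c ++ wC))) pc.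
  by exists wA, a; rewrite ap.
have [x [y [sx sy xy xp py]]] := crossing_edge_above cross.
have far z t : suffix z (s ++ w) -> ~~ wadj z (t ++ wB).
  by apply: nadj_subtree; rewrite // wn wBn.
exists ((x, y) :: map (shift wB) M); split; last 2 first.
- by rewrite /= size_map Mm.
- rewrite /= !(leq_ltn_trans (size_suffix _) sd) //= all_map.
  by apply: sub_all dM => f /=; rewrite !size_cat wBn !ltn_add2r.
apply/andP; split; first by rewrite /= xy xp py.
rewrite /= indM andbT all_map; apply/allP => f _ /=.
by rewrite far // wadjC far.
Qed.

Definition has_matching (d m : nat) : Prop :=
  forall rk : seq bool -> nat, {in [pred s | size s < d] &, injective rk} ->
  exists p, matching_at rk d m p.

Lemma has_matching2 : has_matching 2 1.
Proof.
move=> rk rkI; pose r : seq bool := [::]; pose x := [:: true].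
have ne : rk r != rk x by apply/eqP => /rkI; rewrite !inE => /(_ isT isT).
case: (ltngtP (rk r) (rk x)) ne => // lt _.
  by exists (rk r), [:: (r, x)]; split=> //; rewrite /cut_matching /= leqnn lt.
by exists (rk x), [:: (x, r)]; split=> //; rewrite /cut_matching /= leqnn lt.
Qed.

(** Three distinct parents of the roots are needed, so these parents are taken
    at level 2: one level higher there are only two nodes. *)
Lemma has_matching_step d m :
  0 < m -> has_matching d m -> has_matching (d + 3) m.+1.
Proof.
move=> m0 IH rk rkI.
have sub w : size w = 3 -> exists p, matching_at (fun s => rk (s ++ w)) d m p.
  move=> w3; apply: IH => s t; rewrite !inE => sd td /rkI.
  by rewrite !inE !size_cat w3 !ltn_add2r => /(_ sd td)/catl_inj.
pose w1 := [:: false; false; false]; pose w2 := [:: false; false; true].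
pose w3 := [:: false; true; false].
have [p1 m1] := sub w1 erefl; have [p2 m2] := sub w2 erefl.
have [p3 m3] := sub w3 erefl.
case: (leqP p1 p2) => [p12|/ltnW p21]; case: (leqP p2 p3) => [p23|/ltnW p32].
- by exists p2; apply: (matching_at_middle _ _ _ _ _ m0 m1 m2 m3).
- case: (leqP p1 p3) => [p13|/ltnW p31].
    by exists p3; apply: (matching_at_middle _ _ _ _ _ m0 m1 m3 m2).
  by exists p1; apply: (matching_at_middle _ _ _ _ _ m0 m3 m1 m2).
- case: (leqP p1 p3) => [p13|/ltnW p31].
    by exists p1; apply: (matching_at_middle _ _ _ _ _ m0 m2 m1 m3).
  by exists p3; apply: (matching_at_middle _ _ _ _ _ m0 m2 m3 m1).
- by exists p2; apply: (matching_at_middle _ _ _ _ _ m0 m3 m2 m1).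
Qed.

Lemma has_matching_cbtree k : has_matching (3 * k + 2) k.+1.
Proof.
elim: k => [|k IH]; first exact: has_matching2.
by rewrite (_ : 3 * k.+1 + 2 = 3 * k + 2 + 3); [exact: has_matching_step | lia].
Qed.

Lemma has_matching_le d d' m : d <= d' -> has_matching d m -> has_matching d' m.
Proof.
move=> dd' H rk rkI; have [|p [M [cM Mm dM]]] := H rk.
  by move=> s t; rewrite !inE => sd td; apply: rkI; rewrite inE (leq_trans _ dd').
exists p, M; split=> //; apply: sub_all dM => f /andP[f1 f2].
by rewrite !(leq_trans _ dd').
Qed.

(** A ranking of the nodes extends to all words by sending the words that are
    too long to an arbitrary node; injectivity of the extension matters only
    below length [d]. *)
Lemma has_matching_thinness d m : 0 < d -> has_matching d m -> m <= thinness (cbtree d).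
Proof.
move=> d0 H; apply: leq_thinness => rk rkI.
have [r _] := @word_exists d [::] d0.
pose node s : cbtree d := odflt r [pick u | @word d u == s].
have nodeK s : size s < d -> word (node s) = s.
  move=> sd; rewrite /node; case: pickP => [u /eqP //|none].
  by have [u us] := word_exists sd; move: (none u); rewrite us eqxx.
have [|p [M [cM Mm dM]]] := H (rk \o node).
  move=> s t; rewrite !inE => sd td /= /rkI/(congr1 (@word d)).
  by rewrite !nodeK.
exists p, [seq (node f.1, node f.2) | f <- M]; split; last by rewrite size_map.
case/andP: cM => cutM indM; apply/andP; split.
  rewrite all_map; apply/allP => f fM; move/allP/(_ _ fM): cutM.
  move/allP/(_ _ fM): dM => /andP[f1 f2] /=.
  by rewrite cbadjE !nodeK.
rewrite pairwise_map; apply: (sub_in_pairwise _ dM indM) => f g.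
rewrite !unfold_in => /andP[f1 f2] /andP[g1 g2] /=.
by rewrite !(cbadjE, nodeK).
Qed.

Lemma thinness_cbtree d k : 3 * k + 2 <= d -> k < thinness (cbtree d).
Proof.
move=> kd; apply: has_matching_thinness; first by apply: leq_trans kd; lia.
exact: (has_matching_le kd (@has_matching_cbtree k)).
Qed.

(** * The logarithmic bound *)

Local Open Scope ring_scope.

Lemma ln_cbtree_le (R : realType) d : ln ((2 ^ d - 1)%N%:R) <= d%:R :> R.
Proof.
(* For d = 0 this is the default value of ln at 0. *)
have [->|d0] := posnP d; first by rewrite ln0.
have pos : (0 < 2 ^ d - 1)%N by rewrite subn_gt0 -{1}(expn0 2) ltn_exp2l.
have ln2 : ln 2 <= 1 :> R by have := @le_ln1Dx R 1; apply; lra.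
apply: (@le_trans _ _ (ln (2 ^+ d))).
  by rewrite ler_ln ?posrE ?ltr0n ?exprn_gt0 // -natrX ler_nat leq_subr.
by rewrite lnXn // -[leRHS]mulr1 mulr_natl lerMn2r ln2 orbT.
Qed.

Theorem theorem3 (R : realType) :
  (exists (c : R) (d0 : nat), 0 < c /\
     forall d : nat, (d0 <= d)%N ->
       c * ln ((2 ^ d - 1)%N%:R) <= (thinness (cbtree d))%:R)
  /\
  (forall k : nat, exists G : sgraph, is_tree G /\ (k <= thinness G)%N).
Proof.
split.
  (* For k the floor of (d - 2) / 3 one has d <= 3 k + 4 <= 4 (k + 1). *)
  exists (4%:R^-1), 2; split=> [|d d2]; first by rewrite invr_gt0.
  rewrite ler_pdivrMl ?ltr0n //; apply: le_trans (ln_cbtree_le R d) _.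
  rewrite -natrM ler_nat.
  have := @thinness_cbtree d ((d - 2) %/ 3)%N; lia.
move=> k; exists (cbtree (3 * k + 2)); split; first by apply: cbtree_is_tree; lia.
exact: ltnW (thinness_cbtree (leqnn _)).
Qed.
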